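(* For every AT-free graph $G$, $\operatorname{box}(G)\le 3\Delta(G)$, where $\Delta(G)$ is the maximum degree of $G$.
   Context: An asteroidal triple in $G$ is an independent set of three vertices such that each pair is joined by a path avoiding the (closed) neighborhood of the third; $G$ is AT-free if it has no asteroidal triple. The boxicity $\operatorname{box}(G)$ is the minimum $b$ such that $G$ is the intersection graph of axis-parallel boxes in $\mathbb{R}^b$ (products of $b$ closed intervals), one box per vertex.
   Formalization: The graph is assumed to have at least one edge (maximum degree at least 1), since the edgeless graph on two vertices is AT-free with maximum degree 0 but boxicity 1. *)

(* Defs.v *)
From mathcomp Require Import all_boot.
From Stdlib Require Import Reals.

Set Implicit Arguments.
Unset Strict Implicit.
Unset Printing Implicit Defensive.

Definition simple_graph (T : finType) (e : rel T) : Prop :=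
  symmetric e /\ irreflexive e.

Definition degree (T : finType) (e : rel T) (x : T) : nat := #|[set y | e x y]|.
Definition max_degree (T : finType) (e : rel T) : nat := \max_(x : T) degree e x.

Definition closed_nbhd (T : finType) (e : rel T) (z : T) : {set T} :=
  [set w | (w == z) || e z w].

Definition path_avoiding (T : finType) (e : rel T) (z x y : T) : bool :=
  [&& x \notin closed_nbhd e z, y \notin closed_nbhd e z &
    connect (fun u v => [&& e u v, u \notin closed_nbhd e z & v \notin closed_nbhd e z]) x y].

Definition independent3 (T : finType) (e : rel T) (x y z : T) : bool :=
  [&& x != y, y != z, x != z, ~~ e x y, ~~ e y z & ~~ e x z].

Definition asteroidal_triple (T : finType) (e : rel T) (x y z : T) : bool :=
  [&& independent3 e x y z, path_avoiding e z x y,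
      path_avoiding e x y z & path_avoiding e y x z].

Definition AT_free (T : finType) (e : rel T) : Prop :=
  forall x y z : T, ~~ asteroidal_triple e x y z.

Definition box_representation (T : finType) (e : rel T) (b : nat)
    (lo hi : T -> 'I_b -> R) : Prop :=
  (forall x i, (lo x i <= hi x i)%R) /\
  (forall x y, x != y ->
     (e x y <-> exists p : 'I_b -> R,
        forall i, (lo x i <= p i <= hi x i)%R /\ (lo y i <= p i <= hi y i)%R)).

Definition has_box_rep (T : finType) (e : rel T) (b : nat) : Prop :=
  exists lo hi : T -> 'I_b -> R, box_representation e lo hi.

(* box(G) <= k  :<->  the minimum b with a box representation in R^b is <= k,
   i.e. some b <= k admits a box representation. *)
Definition boxicity_le (T : finType) (e : rel T) (k : nat) : Prop :=
  exists b, (b <= k)%N /\ has_box_rep e b.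

(* Main.v *)
(**
An injective layout [pos] in which adjacent positions differ by less than [k]
gives a box representation of dimension [k], one coordinate for each residue
class modulo [k]. Such a layout with [k = 3 * Delta] comes from cutting the
vertices into consecutive blocks of at most [Delta] vertices so that edges stretch
over at most two further blocks.

For the blocks, call [y] and [z] unrelated with respect to [x] if [x] reaches
each of them while avoiding the closed neighborhood of the other. In an AT-free
graph every component has an admissible vertex [x], one without unrelated pairs:
maximize the sum over [u] of [2 ^ size], the size being that of the component of
[u] in [G - N[x]]. Take the breadth-first levels of such an [x] and choose,
from the last level down, [X i] among the lower neighbors of [X i.+1] with the
fewest lower neighbors. Admissibility then forces every vertex of level [i] to be
adjacent to [X i.-1] or to [X i], so the neighborhoods of the [X i] cover the blocks.
*)
Require Import Defs.
From Stdlib Require Import Reals Lra.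
From mathcomp Require Import all_boot zify.

Set Implicit Arguments.
Unset Strict Implicit.
Unset Printing Implicit Defensive.

(** * Boxes from layouts of small bandwidth *)

Lemma eqmod_ltn_leq m n k : m = n %[mod k] -> m < n + k -> m <= n.
Proof.
move=> eq_mn lt_m; have := divn_eq m k; have := divn_eq n k; rewrite eq_mn.
have [le_q|lt_q] := leqP (m %/ k) (n %/ k); nia.
Qed.

Lemma box_rep_of_bandwidth (T : finType) (e : rel T) (k : nat) (pos : T -> nat) :
  simple_graph e -> injective pos -> 0 < k ->
  (forall u v, e u v -> pos u < pos v + k) ->
  has_box_rep e k.
Proof.
move=> [eC _] pos_inj k0 bw.
(* In the coordinate of class [c], a vertex of class [c] is the point [pos] and any
   other vertex [u] is an interval [[bot u c, M]], which starts just after the last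
   earlier non-neighbor of [u] in that class. *)
pose bot u c := \max_(v | [&& pos v %% k == c, ~~ e u v & pos v < pos u]) (pos v).+1.
pose M := \max_v pos v.
have posM v : pos v <= M by apply: (leq_bigmax v).
have botM u c : bot u c <= M.
  by apply/bigmax_leqP => v /and3P[_ _ /leq_trans]; apply.
have bot_nbr u v : e u v -> bot u (pos v %% k) <= pos v.
  move=> euv; apply/bigmax_leqP => w /and3P[/eqP cw nuw wu].
  have := bw _ _ euv; have wv : pos w != pos v.
    by apply: contraNneq nuw => /pos_inj->.
  by have := @eqmod_ltn_leq (pos w) (pos v) k cw; lia.
exists (fun u (c : 'I_k) => INR (if pos u %% k == c then pos u else bot u c)).
exists (fun u (c : 'I_k) => INR (if pos u %% k == c then pos u else M)).
split=> [u c|u v neq_uv].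
  by apply: le_INR; apply/leP; case: eqP.
have INRle m n : Rle (INR m) (INR n) <-> m <= n.
  by split=> [/INR_le/leP|/leP/le_INR].
split=> [euv|[p hp]].
  (* A common point: the position of whichever vertex is a point in this coordinate, otherwise [M],
     where all the longer intervals end. Both cannot be points: they lie less than [k] apart. *)
  exists (fun c : 'I_k => INR (if pos u %% k == c then pos u
                 else if pos v %% k == c then pos v else M)) => c.
  have evu : e v u by rewrite eC.
  have := bw _ _ euv; have := bw _ _ evu => b1 b2.
  have neq_pos : pos u != pos v by apply: contraNneq neq_uv => /pos_inj->.
  have := bot_nbr _ _ euv; have := bot_nbr _ _ evu => n1 n2.
  rewrite !INRle.
  case: eqP => cu; case: eqP => cv; rewrite ?posM ?botM ?leqnn ?andbT //.
  - case/eqP: neq_pos; apply/eqP; rewrite eqn_leq.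
    have eq_uv : pos u = pos v %[mod k] by rewrite cu.
    by rewrite (eqmod_ltn_leq eq_uv b2) (eqmod_ltn_leq (esym eq_uv) b1).
  - by rewrite -cu; do !split.
  - by rewrite -cv; do !split.
wlog lt_vu : u v neq_uv hp / pos v < pos u.
  move=> IH; have : pos u != pos v by apply: contraNneq neq_uv => /pos_inj->.
  rewrite neq_ltn => /orP[lt|lt]; last exact: IH lt.
  rewrite eC; apply: IH lt; first by rewrite eq_sym.
  by move=> i; case: (hp i).
apply: contraT => nuv.
(* The coordinate of the class of [v] separates the two: there [u] is a later point or an interval
   starting after [v]. *)
have [] := hp (Ordinal (ltn_pmod (pos v) k0)); rewrite /= eqxx.
case: eqP => [cu|ncu] [h1 h2] [h3 h4].
  suff : (pos u <= pos v)%N by lia.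
  by apply/INRle; lra.
have : bot u (pos v %% k) <= pos v by apply/INRle; lra.
suff : pos v < bot u (pos v %% k) by lia.
by apply: (leq_bigmax_cond v); rewrite eqxx nuv lt_vu.
Qed.

(** Each block receives [k] consecutive slots, and an edge meets at most [s.+1] successive
    blocks. *)
Lemma bandwidth_of_blocks (T : finType) (e : rel T) (k s : nat) (blk : T -> nat) :
  (forall j, #|[set v | blk v == j]| <= k) ->
  (forall u v, e u v -> blk u <= blk v + s) ->
  exists2 pos : T -> nat, injective pos &
    forall u v, e u v -> pos u < pos v + s.+1 * k.
Proof.
move=> fib stretch.
pose idx u := index u (enum [set v | blk v == blk u]).
have idx_lt u : idx u < k.
  by apply: leq_trans (fib (blk u)); rewrite cardE index_mem mem_enum inE.
exists (fun u => blk u * k + idx u) => [u v eq_pos|u v /stretch].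
  have := idx_lt u; have := idx_lt v => lv lu.
  have eq_blk : blk u = blk v by nia.
  have : idx u = idx v by nia.
  rewrite /idx eq_blk => /(congr1 (nth u (enum [set w | blk w == blk v]))).
  by rewrite !nth_index // mem_enum inE ?eq_blk.
by have := idx_lt u; nia.
Qed.

(** * Existence of admissible vertices *)

Section Avoiding.
Variables (T : finType) (e : rel T).
Hypothesis sg : simple_graph e.
Let eC : symmetric e := sg.1.
Local Notation avoid := (path_avoiding e).
Local Notation "N[ z ]" := (closed_nbhd e z).

Lemma closed_nbhdC x y : (x \in N[y]) = (y \in N[x]).
Proof. by rewrite !inE eq_sym eC. Qed.

Lemma path_avoiding_refl z x : avoid z x x = (x \notin N[z]).
Proof. by rewrite /path_avoiding connect0 andbT andbb. Qed.

Lemma path_avoidingC z x y : avoid z x y -> avoid z y x.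
Proof.
case/and3P=> nx ny c; apply/and3P; split=> //.
rewrite (sym_connect_sym _) // => u v; rewrite eC.
by congr (_ && _); rewrite andbC.
Qed.

Lemma path_avoiding_trans z x y w : avoid z x y -> avoid z y w -> avoid z x w.
Proof.
case/and3P=> nx ny c /and3P[_ nw c']; apply/and3P; split=> //.
exact: connect_trans c c'.
Qed.

Lemma path_avoiding_step z x y w :
  avoid z x y -> e y w -> w \notin N[z] -> avoid z x w.
Proof.
move=> a eyw nw; apply: (path_avoiding_trans a).
case/and3P: a => _ ny _; apply/and3P; split=> //.
by apply: connect1; rewrite eyw ny.
Qed.

Lemma path_avoiding_ind z x (P : T -> Prop) :
  P x ->
  (forall u v, avoid z x u -> P u -> e u v -> v \notin N[z] -> P v) ->
  forall y, avoid z x y -> P y.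
Proof.
move=> Px step y /and3P[nx _ /connectP[p pth ->]] {y}.
suff: avoid z x (last x p) /\ P (last x p) by case.
elim/last_ind: p pth => [|p v IH]; first by rewrite path_avoiding_refl.
rewrite rcons_path last_rcons => /andP[/IH[a Pu] /and3P[euv nu nv]].
by split; [apply: path_avoiding_step a euv nv|apply: step a Pu euv nv].
Qed.

Lemma connect_of_path_avoiding z x y : avoid z x y -> connect e x y.
Proof.
move: y; apply: path_avoiding_ind => // u v _ cu euv _.
by apply: connect_trans cu (connect1 euv).
Qed.

Definition unrelated x y z := avoid z x y && avoid y x z.

Lemma unrelatedC x y z : unrelated x y z = unrelated x z y.
Proof. by rewrite /unrelated andbC. Qed.

(* The component of [u] in [G - N[x]], empty when [u] lies in [N[x]]. *)
Definition far_comp x u : {set T} := [set v | avoid x u v].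
Definition potential x := \sum_u 2 ^ #|far_comp x u|.

Hypothesis atf : AT_free e.

(** A third path would complete an asteroidal triple; independence follows from the endpoint
    conditions of the two given paths. *)
Lemma unrelated_separated x y z : unrelated x y z -> ~~ avoid x y z.
Proof.
case/andP=> a1 a2; apply: contra (atf x y z) => a3.
have [nx ny _] := and3P a1; have [nx' nz _] := and3P a2.
rewrite /asteroidal_triple a1 a3 a2 !andbT /independent3.
move: nx ny nx'; rewrite !inE !negb_or => /andP[-> nzx] /andP[-> nzy] /andP[-> nyx].
by rewrite (eC x) nyx (eC y) nzy (eC x) nzx.
Qed.

Lemma unrelated_potential x y z :
  unrelated x y z -> #|far_comp x z| <= #|far_comp x y| ->
  potential x < potential z.
Proof.
move=> un le_zy; have sep := unrelated_separated un.
have /andP[a1 a2] := un.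
have [nxz _ _] := and3P a1; have [nxy nzy _] := and3P a2.
have nyx : y \notin N[x] by rewrite closed_nbhdC.
have nzx : z \notin N[x] by rewrite closed_nbhdC.
set A := far_comp x y in le_zy; set B := far_comp x z in le_zy.
(* A component of [G - N[x]] that meets [N[z]] contains [z], so every component but [B] survives in
   [G - N[z]]. *)
have sub u : u \notin B -> {subset far_comp x u <= far_comp z u}.
  move=> nu v; rewrite inE => a; rewrite inE.
  have far w : avoid x u w -> w \notin N[z].
    move=> auw; apply: contra nu => wz; rewrite inE; apply: path_avoidingC.
    move: wz; rewrite inE => /orP[/eqP<-//|ezw].
    by apply: path_avoiding_step auw _ nzx; rewrite eC.
  have nux : u \notin N[x] by case/and3P: a.
  move: v a; apply: path_avoiding_ind => [|v w av bv evw nw].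
    by rewrite path_avoiding_refl; apply: far; rewrite path_avoiding_refl.
  by apply: (path_avoiding_step bv evw); apply: far; apply: (path_avoiding_step av evw nw).
have disj u : u \in A -> u \notin B.
  rewrite !inE => ay; apply: contra sep => az.
  exact: path_avoiding_trans ay (path_avoidingC az).
have compE w u : u \in far_comp x w -> #|far_comp x u| = #|far_comp x w|.
  rewrite inE => a; apply: eq_card => v; rewrite !inE; apply/idP/idP.
    exact: path_avoiding_trans a.
  exact/path_avoiding_trans/path_avoidingC.
(* Passing from [x] to [z], the component [A] of [y] gains [x], and only the
   component [B] of [z], which is not larger than [A], can lose. *)
have growA u : u \in A -> #|A| < #|far_comp z u|.
  move=> uA; rewrite -(compE _ _ uA); apply: proper_card; apply/properP; split.
    by apply/subsetP/sub/disj.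
  exists x; last by rewrite inE /path_avoiding !inE eqxx /= andbF.
  have : y \in far_comp x u by rewrite inE path_avoidingC //; move: uA; rewrite inE.
  move/(sub _ (disj _ uA)); rewrite !inE => /path_avoiding_trans; apply.
  exact: path_avoidingC.
have B0 : 0 < #|B| by apply/card_gt0P; exists z; rewrite inE path_avoiding_refl.
rewrite /potential (bigID (mem B)) [ltnRHS](bigID (mem B)) /=.
have exprA (F : T -> nat) :
    \sum_(u | u \notin B) F u = \sum_(u in A) F u + \sum_(u | (u \notin B) && (u \notin A)) F u.
  rewrite (bigID (mem A)) /=; congr (_ + _); apply: eq_bigl => u.
  by rewrite andbC; case: (boolP (u \in A)) => // /disj.
rewrite !exprA.
have sumB : \sum_(u in B) 2 ^ #|far_comp x u| = #|B| * 2 ^ #|B|.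
  by rewrite -sum_nat_const; apply: eq_bigr => u /compE->.
have sumA : \sum_(u in A) 2 ^ #|far_comp x u| = #|A| * 2 ^ #|A|.
  by rewrite -sum_nat_const; apply: eq_bigr => u /compE->.
have sumA' : #|A| * 2 ^ #|A|.+1 <= \sum_(u in A) 2 ^ #|far_comp z u|.
  by rewrite -sum_nat_const; apply: leq_sum => u /growA ltA; rewrite leq_exp2l.
(* Strictness comes from here: even an empty component contributes [2 ^ 0]. *)
have sumB' : 0 < \sum_(u in B) 2 ^ #|far_comp z u|.
  apply: leq_trans B0 _; rewrite -sum1_card; apply: leq_sum => u _.
  by rewrite expn_gt0.
have rest : \sum_(u | (u \notin B) && (u \notin A)) 2 ^ #|far_comp x u|
     <= \sum_(u | (u \notin B) && (u \notin A)) 2 ^ #|far_comp z u|.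
  apply: leq_sum => u /andP[uB _]; rewrite leq_exp2l //.
  exact/subset_leq_card/subsetP/sub.
(* Each term over [A] at least doubles, and this gain covers all that the terms over [B] can
   lose. *)
have leBA : #|B| * 2 ^ #|B| <= #|A| * 2 ^ #|A| by rewrite leq_mul ?leq_exp2l.
rewrite sumB sumA !addnA -addSn leq_add // -add1n leq_add //.
by apply: leq_trans sumA'; rewrite expnS mulnCA mul2n -addnn leq_add2r.
Qed.

Lemma admissible_exists x0 :
  exists2 x, connect e x0 x & forall y z, ~~ unrelated x y z.
Proof.
have [x cx maxx] := arg_maxnP potential (connect0 e x0).
exists x => // y z; apply/negP.
wlog le_zy : y z / #|far_comp x z| <= #|far_comp x y|.
  by move=> IH un; case/orP: (leq_total #|far_comp x z| #|far_comp x y|) => /IH; apply;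
    rewrite // unrelatedC.
move=> un; have /andP[_ /connect_of_path_avoiding cz] := un.
have := leq_ltn_trans (maxx z (connect_trans cx cz)) (unrelated_potential un le_zy).
by rewrite ltnn.
Qed.

(** * Breadth-first levels and the blocks of one component *)

Lemma distance_exists x :
  exists d : T -> nat, [/\ d x = 0, forall u, connect e x u -> d u = 0 -> u = x,
    forall u v, connect e x u -> e u v -> d v <= (d u).+1 &
    forall v, connect e x v -> 0 < d v ->
      exists u, [/\ connect e x u, e u v & d v = (d u).+1]].
Proof.
pose ball n := iter n (fun S : {set T} => S :|: [set v | [exists u in S, e u v]]) [set x].
have ballS n v : (v \in ball n.+1) = (v \in ball n) || [exists u in ball n, e u v].
  by rewrite /ball iterS !inE.
have ball_step n u v : u \in ball n -> e u v -> v \in ball n.+1.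
  by move=> un euv; rewrite ballS; apply/orP; right; apply/existsP; exists u; rewrite un.
have conn_ball u : connect e x u -> exists n, u \in ball n.
  case/connectP=> p; elim/last_ind: p u => [|p v IH] u /=.
    by move=> _ ->; exists 0; rewrite inE.
  rewrite rcons_path last_rcons => /andP[/IH/(_ erefl)[n un] euv] ->.
  by exists n.+1; apply: ball_step un euv.
have ball_conn n u : u \in ball n -> connect e x u.
  elim: n u => [|n IH] u; first by rewrite inE => /eqP->.
  rewrite ballS => /orP[/IH//|/existsP[w /andP[/IH cw ewu]]].
  by apply: connect_trans cw (connect1 ewu).
(* Outside the component of [x] the value of [d] is immaterial. *)
have /fin_all_exists[d dP] u : exists n, connect e x u ->
    u \in ball n /\ forall m, u \in ball m -> n <= m.
  case: (boolP (connect e x u)) => [cu|]; last by exists 0.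
  by have [n nP nmin] := ex_minnP (conn_ball u cu); exists n.
exists d; split.
- by have [_ /(_ 0)] := dP x (connect0 _ _); rewrite inE eqxx leqn0 => /(_ isT)/eqP.
- by move=> u /dP[+ _] d0; rewrite d0 inE => /eqP.
- move=> u v cu euv; have cv := connect_trans cu (connect1 euv).
  by have [_ ->//] := dP v cv; apply: ball_step euv; case: (dP u cu).
- move=> v cv d0; have [] := dP v cv; case E: (d v) d0 => [//|n] _.
  rewrite ballS => /orP[vn /(_ _ vn)|]; first by rewrite ltnn.
  case/existsP=> u /andP[un euv] minv; exists u; have cu := ball_conn _ _ un.
  split=> //; have [udu minu] := dP u cu; congr _.+1; apply/eqP.
  by rewrite eqn_leq minu // andbT -ltnS minv //; apply: ball_step udu euv.
Qed.

Lemma component_blocks x0 :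
  0 < max_degree e ->
  exists blk : T -> nat,
    (forall j, #|[set v | connect e x0 v & blk v == j]| <= max_degree e) /\
    (forall u v, connect e x0 u -> e u v -> blk u <= blk v + 2).
Proof.
move=> deg0; have [x cx adm] := admissible_exists x0.
have cC : connect_sym e by apply: sym_connect_sym.
have ccx u : connect e x0 u = connect e x u by apply: same_connect.
have [d [dx d0 dS dpred]] := distance_exists x.
have cn u v : connect e x u -> e u v -> connect e x v.
  by move=> cu euv; apply: connect_trans cu (connect1 euv).
(* On a shortest path from [x] to [w], the vertices before [w] have level at most [d z - 2], too low
   for [N[z]]. *)
have low_avoid z w : connect e x z -> connect e x w -> d w < d z -> w \notin N[z] -> avoid z x w.
  move=> cz; move E: (d w) => n; elim: n w E => [|n IH] w E cw ltd nw.
    by move: nw; rewrite (d0 w cw E) path_avoiding_refl.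
  have [|u [cu euw]] := dpred w cw; first by rewrite E.
  rewrite E => -[du]; have nu : u \notin N[z].
    rewrite inE; apply/norP; split; first by apply/eqP => zu; move: ltd; rewrite -zu du; lia.
    by apply/negP; rewrite eC => /(dS _ _ cu); lia.
  by apply: path_avoiding_step euw nw; apply: IH => //; lia.
pose down w := [set u | e u w & d w == (d u).+1].
have side_avoid a z w : connect e x a -> connect e x z -> d z = d a -> z != a ->
    ~~ e z a -> w \in down a -> ~~ e w z -> avoid z x a.
  move=> ca cz dz nza neza; rewrite inE => /andP[ewa /eqP dw] newz.
  have cw : connect e x w by apply: cn ca _; rewrite eC.
  have nw : w \notin N[z].
    rewrite inE eC; apply/norP; split=> //; apply/eqP => wz.
    by move/eqP: dz; rewrite -wz dw ltn_eqF.
  apply: path_avoiding_step (low_avoid z w cz cw _ nw) ewa _; first by rewrite dz dw.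
  by rewrite inE eq_sym; apply/norP.
(* Otherwise [a] and [z] each have a lower neighbor not adjacent to the other, and [side_avoid]
   makes them unrelated. *)
have card_down a z w : connect e x a -> connect e x z -> d z = d a -> z != a ->
    ~~ e z a -> w \in down a -> ~~ e w z -> #|down z| < #|down a|.
  move=> ca cz dz nza neza wa newz; rewrite ltnNge; apply/negP => le_az.
  have /subsetPn[w' w'z w'a] : ~~ (down z \subset down a).
    apply/negP => sub; have : down z \proper down a.
      by apply/properP; split=> //; exists w => //; rewrite inE (negbTE newz).
    by move/proper_card; rewrite ltnNge le_az.
  apply: (negP (adm a z)); apply/andP; split; first exact: side_avoid wa newz.
  apply: (side_avoid z a w') => //; first by rewrite eq_sym.
    by rewrite eC.
  by move: w'a w'z; rewrite !inE dz => /nandP[//|/negP nd /andP[_ /nd]].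
pose dominating a := forall z w, connect e x z -> d z = d a -> z != a -> ~~ e z a ->
  w \in down a -> e w z.
have /fin_all_exists[nxt nxtP] p : exists a, connect e x p -> 0 < d p ->
    [/\ connect e x a, e a p, d p = (d a).+1 & dominating a].
  have [/andP[cp dp]|] := boolP (connect e x p && (0 < d p)); last first.
    by move=> n; exists x => cp dp; rewrite cp dp in n.
  have [u [_ eup dpu]] := dpred p cp dp.
  have up : u \in down p by rewrite inE eup dpu eqxx.
  have [a] := @arg_minnP _ u (mem (down p)) (fun a => #|down a|) up.
  rewrite /= inE => /andP[eap /eqP da] mina.
  exists a => _ _; have ca : connect e x a by apply: cn cp _; rewrite eC.
  split=> // z w cz dz nza neza wa; apply: contraT => newz.
  (* If [z] is adjacent to [p], it competes with [a] and contradicts minimality. If not, [p]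
     (through [w] and [a]) and [z] are unrelated. *)
  have [ezp|nezp] := boolP (e z p).
    have := card_down a z w ca cz dz nza neza wa newz; rewrite ltnNge mina //=.
    by rewrite inE ezp dz da eqxx.
  have nzp : z \notin N[p].
    rewrite inE eC; apply/norP; split=> //; apply/eqP => zp.
    by move: da; rewrite -zp dz => /eqP; rewrite ltn_eqF.
  case/negP: (adm p z); apply/andP; split; last first.
    by apply: low_avoid => //; rewrite dz da.
  apply: path_avoiding_step (side_avoid a z w ca cz dz nza neza wa newz) eap _.
  by rewrite closed_nbhdC.
have [m cm maxm] := arg_maxnP d (connect0 e x).
(* The last level has no vertex above it to restrict the choice, so [top] is minimal over the whole
   level. *)
have [top /andP[ctop /eqP dtop] mintop] :=
  @arg_minnP _ m (fun a => connect e x a && (d a == d m)) (fun a => #|down a|)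
    (introT andP (conj cm (eqxx _))).
have domtop : dominating top.
  move=> z w cz dz nza neza wa; apply: contraT => newz.
  have := card_down top z w ctop cz dz nza neza wa newz; rewrite ltnNge mintop //.
  by rewrite cz dz dtop eqxx.
have iterP k : k <= d m -> [/\ connect e x (iter k nxt top),
    d (iter k nxt top) = d m - k & dominating (iter k nxt top)].
  elim: k => [|k IH] le_k; first by rewrite subn0; split.
  have [ck dk _] := IH (ltnW le_k).
  have [//||c1 _ d1 dom1] := nxtP (iter k nxt top); first by rewrite dk subn_gt0.
  by rewrite iterS; split=> //; rewrite subnS -dk d1.
pose X i := iter (d m - i) nxt top.
have XP i : i <= d m -> [/\ connect e x (X i), d (X i) = i & dominating (X i)].
  by move=> le_im; have [] := iterP _ (leq_subr i (d m)); rewrite subKn.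
have Xe i : i < d m -> e (X i) (X i.+1).
  move=> lt_im; have [c1 d1 _] := XP _ lt_im.
  have [|_ + _ _] := nxtP _ c1; first by rewrite d1.
  by have -> : X i = nxt (X i.+1) by rewrite /X -(subnSK lt_im).
(* Late vertices move up one block, so that block [i.+1] lies in the neighborhood of [X i]; block 0
   is just [x]. Levels of adjacent vertices differ by at most 1 and lateness adds at most 1, hence
   the stretch 2. *)
pose late z := (0 < d z) && ~~ e z (X (d z).-1).
exists (fun z => d z + late z); split=> [[|i]|u v]; last first.
- rewrite ccx => cu euv; have := dS u v cu euv; have := dS v u (cn _ _ cu euv).
  by rewrite eC => /(_ euv); case: (late u); case: (late v); lia.
- apply: leq_trans (leq_bigmax (X i)); apply/subset_leq_card/subsetP => v.
  rewrite !inE ccx => /andP[cv /eqP]; have dv : d v <= d m by apply: maxm.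
  case lv: (late v); rewrite ?addn1 ?addn0 => Ev; last first.
    by move: lv; rewrite /late Ev /= => /negbFE; rewrite eC.
  (* A late [v] of level [i.+1] misses [X i], a lower neighbor of [X i.+1]; as [X i.+1] is
     dominating, [v] must be adjacent to it. *)
  case: Ev => Ev; case/andP: lv; rewrite Ev; case: i Ev => // i Ev _ /= nev.
  rewrite Ev in dv; have [cX dX dom] := XP _ dv; apply: contraT; rewrite eC => nevX.
  case/negP: (nev); rewrite eC; have eX := Xe i dv.
  apply: (dom v) => //; first by rewrite dX.
    by apply: contraNneq nevX => vX; move: nev; rewrite vX eC eX.
  by rewrite inE eX; have [_ -> _] := XP i (ltnW dv); rewrite dX eqxx.
apply: leq_trans deg0; rewrite -(cards1 x); apply/subset_leq_card/subsetP => v.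
by rewrite !inE ccx addn_eq0 => /and3P[cv /eqP /(d0 v cv)->].
Qed.

End Avoiding.

(** * Assembling the components *)

Lemma graph_blocks (T : finType) (e : rel T) :
  simple_graph e -> AT_free e -> 0 < max_degree e ->
  exists blk : T -> nat,
    (forall j, #|[set v | blk v == j]| <= max_degree e) /\
    (forall u v, e u v -> blk u <= blk v + 2).
Proof.
move=> sg atf deg0; have cC : connect_sym e by apply: sym_connect_sym sg.1.
have /fin_all_exists[B BP] r := component_blocks sg atf r deg0.
pose N := \max_r \max_u B r u.
have BN r u : B r u < N.+1.
  by rewrite ltnS; apply: leq_trans (leq_bigmax r); apply: (leq_bigmax u).
(* Each component gets its own range of [N.+1] block numbers, so no block mixes components. *)
exists (fun u => enum_rank (root e u) * N.+1 + B (root e u) u); split=> [j|u v euv].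
  have [->|[u]] := set_0Vmem [set v | enum_rank (root e v) * N.+1 + B (root e v) v == j].
    by rewrite cards0.
  rewrite inE => /eqP uj; apply: leq_trans ((BP (root e u)).1 (B (root e u) u)).
  apply/subset_leq_card/subsetP => v; rewrite !inE -uj => /eqP eq_blk.
  have : enum_rank (root e v) = enum_rank (root e u) :> nat.
    by have := BN (root e u) u; have := BN (root e v) v; nia.
  move/val_inj/enum_rank_inj => eq_root; move: eq_blk; rewrite eq_root.
  by move/addnI->; rewrite eqxx -eq_root cC connect_root.
have -> : root e v = root e u by apply/eqP; rewrite root_connect // cC connect1.
rewrite -addnA leq_add2l; apply: (BP _).2 euv.
by rewrite cC connect_root.
Qed.

Theorem theorem7 (T : finType) (e : rel T) :
  simple_graph e -> AT_free e -> (0 < max_degree e)%N ->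
  boxicity_le e (3 * max_degree e).
Proof.
move=> sg atf deg0; exists (3 * max_degree e); split=> //.
have [blk [fib stretch]] := graph_blocks sg atf deg0.
have [pos pos_inj bw] := bandwidth_of_blocks fib stretch.
by apply: (box_rep_of_bandwidth sg pos_inj) bw; rewrite muln_gt0.
Qed.
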